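(* Let $q=p^l$ be a prime power ($p$ prime) and $\mathbb{F}_q$ the finite field of order $q$. Let $\mathcal{D}$ be a $1$-$(v,k,r)$ design with blocks $B_1,\ldots,B_b$ and let $a\in\mathbb{F}_p$, $a\neq 0$, be such that $k\equiv a\pmod p$ and $|B_i\cap B_j|\equiv 0\pmod p$ for all $i,j\in\{1,\ldots,b\}$, $i\neq j$. Let $G$ be an automorphism group of $\mathcal{D}$ which acts on $\mathcal{D}$ with $n$ point orbits, all of length $w$, and $m$ block orbits, all of length $w$, and let $O$ be the orbit matrix of $\mathcal{D}$ under the action of $G$. Then the linear code spanned by the rows of the matrix $[\sqrt{-a}\,I_m,\ O]$ is a self-orthogonal $[m+n,m]$ code over $\mathbb{F}$, where $\mathbb{F}=\mathbb{F}_q$ if $-a$ is a square in $\mathbb{F}_q$, and $\mathbb{F}=\mathbb{F}_{q^2}$ otherwise. If $m=n$, the obtained code is self-dual.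
   Context: A $1$-$(v,k,r)$ design is a finite incidence structure with $v$ points and $b$ blocks such that every block is incident with exactly $k$ points and every point is incident with exactly $r$ blocks. For blocks $B_i,B_j$, $|B_i\cap B_j|$ is the number of points incident with both. An automorphism group of $\mathcal{D}$ is a group of incidence-preserving bijections (points to points, blocks to blocks) of $\mathcal{D}$. If $G$ has point orbits $\mathcal{V}_1,\ldots,\mathcal{V}_n$ and block orbits $\mathcal{B}_1,\ldots,\mathcal{B}_m$, the orbit matrix is the $m\times n$ matrix $[a_{i,j}]$ where $a_{i,j}$ is the number of points of $\mathcal{V}_j$ incident with a block of $\mathcal{B}_i$ (independent of the chosen block); its entries are viewed in the field under consideration. $I_m$ is the identity matrix and $[X,Y]$ denotes horizontal concatenation. For $c\in\mathbb{F}_p$, viewed in $\mathbb{F}$, $\sqrt{c}$ denotes an element of $\mathbb{F}$ whose square is $c$. An $[N,K]$ code has length $N$ and dimension $K$. A code $C\subseteq\mathbb{F}^N$ is self-orthogonal if $C\subseteq C^\perp$ and self-dual if $C=C^\perp$, where $C^\perp$ is the dual under the standard (bilinear) inner product. *)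

(* Defs.v *)
From HB Require Import structures.
From mathcomp Require Import all_boot all_order all_algebra.
From mathcomp Require Import all_fingroup all_solvable all_field.

Set Implicit Arguments.
Unset Strict Implicit.
Unset Printing Implicit Defensive.

Import GRing.Theory.
Local Open Scope ring_scope.

Section Designs.

(* Blocks form a type of their own, so repeated blocks are allowed. *)
Variables (P B : finType) (I : P -> B -> bool).

Definition block_points (x : B) : {set P} := [set y | I y x].

Definition point_blocks (y : P) : {set B} := [set x | I y x].

Definition is_1design (v k r : nat) : Prop :=
  [/\ #|P| = v,
      forall x : B, #|block_points x| = k
    & forall y : P, #|point_blocks y| = r].

Definition design_aut : {set {perm P} * {perm B}} :=
  [set g : {perm P} * {perm B} | [forall y, forall x, I (g.1 y) (g.2 x) == I y x]].

(* The actions of pairs (point permutation, block permutation) on points and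
   on blocks, through the two projections. *)
Definition point_orbits (G : {set {perm P} * {perm B}}) : {set {set P}} :=
  orbit (comp_action 'P (fst_morphism {perm P} {perm B})) G @: [set: P].

Definition block_orbits (G : {set {perm P} * {perm B}}) : {set {set B}} :=
  orbit (comp_action 'P (snd_morphism {perm P} {perm B})) G @: [set: B].

(* The (i, j) entry counts the points of the j-th point orbit on a chosen block
   of the i-th block orbit; orbit_matrixE below shows that the choice is
   irrelevant.  The value 0 for an empty Bs i is never used on orbits. *)
Definition orbit_matrix (m n : nat) (Bs : 'I_m -> {set B})
    (Vs : 'I_n -> {set P}) : 'M[nat]_(m, n) :=
  \matrix_(i, j)
    if [pick x in Bs i] is Some x then #|Vs j :&: block_points x| else 0%N.

End Designs.

Definition enumerates (T : finType) (n : nat) (f : 'I_n -> T) (S : {set T}) :=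
  injective f /\ [set f i | i : 'I_n] = S.

Lemma orbit_matrixE (P B : finType) (I : P -> B -> bool)
    (G : {group {perm P} * {perm B}}) (m n : nat)
    (Bs : 'I_m -> {set B}) (Vs : 'I_n -> {set P}) :
    G \subset design_aut I ->
    enumerates Bs (block_orbits G) -> enumerates Vs (point_orbits G) ->
  forall i j (x : B), x \in Bs i ->
    orbit_matrix I Bs Vs i j = #|Vs j :&: block_points I x|.
Proof.
move=> GA [_ EB] [_ EV] i j x xB; rewrite mxE; case: pickP => [y yB|/(_ x)]; last by rewrite xB.
have /imsetP[x0 _ Ex0] : Bs i \in block_orbits G by rewrite -EB imset_f.
have /imsetP[v0 _ Ev0] : Vs j \in point_orbits G by rewrite -EV imset_f.
rewrite !Ex0 in xB yB *.
case/orbitP: xB => g gG /= Ex; case/orbitP: yB => h hG /= Ey.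
pose t := (h^-1 * g)%g; have tG : t \in G by rewrite groupM ?groupV.
have Et : t.2 y = x.
  by rewrite -Ey -Ex /= /aperm permM permK.
have tA : forall u z, I (t.1 u) (t.2 z) = I u z.
  by move=> u z; have /(subsetP GA) := tG; rewrite inE => /forallP/(_ u)/forallP/(_ z)/eqP.
rewrite -(card_imset _ (@perm_inj _ t.1)); apply: eq_card => z.
apply/imsetP/idP => [[u]|]; rewrite !inE Ev0.
  case/andP=> uO Iu ->; rewrite -Et tA Iu andbT.
  case/orbitP: uO => c cG Ec; apply/orbitP; exists (c * t)%g; first by rewrite groupM.
  by rewrite -Ec /= /aperm permM.
case/andP=> zO Iz; exists (t.1^-1 z)%g; last by rewrite permKV.
rewrite !inE -tA permKV Et Iz andbT.
case/orbitP: zO => c cG Ec; apply/orbitP; exists (c * t^-1)%g; first by rewrite groupM ?groupV.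
by rewrite -Ec /= /aperm permM.
Qed.

(* The prime-field element a viewed in F; this is meant for F of
   characteristic p, with p prime. *)
Definition Fp_in (F : nzRingType) (p : nat) (a : 'F_p) : F :=
  (nat_of_ord a)%:R.

Definition is_square (F : finFieldType) (c : F) : bool :=
  [exists x : F, x ^+ 2 == c].

Section Codes.

Variable F : finFieldType.

Definition code_of (m N : nat) (M : 'M[F]_(m, N)) : {vspace 'rV[F]_N} :=
  <<[seq row i M | i : 'I_m]>>%VS.

Definition dotv (N : nat) (x y : 'rV[F]_N) : F := \sum_(i < N) x 0 i * y 0 i.

Definition dual_code (N : nat) (C : {vspace 'rV[F]_N}) : {pred 'rV[F]_N} :=
  [pred x | [forall y : 'rV[F]_N, (y \in C) ==> (dotv x y == 0)]].

Definition self_orthogonal (N : nat) (C : {vspace 'rV[F]_N}) : Prop :=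
  {subset C <= dual_code C}.

Definition self_dual (N : nat) (C : {vspace 'rV[F]_N}) : Prop :=
  C =i dual_code C.

End Codes.

(* Main.v *)
Require Import Defs.
From HB Require Import structures.
From mathcomp Require Import all_boot all_order all_algebra.
From mathcomp Require Import all_fingroup all_solvable all_field.

Set Implicit Arguments.
Unset Strict Implicit.
Unset Printing Implicit Defensive.

Import GRing.Theory.
Local Open Scope ring_scope.

(** Write O for the orbit matrix.  Everything rests on the congruence
    O O^T = a I mod p.  Fix a block x in the i-th block orbit and add up the
    sizes of its intersections with all blocks of the i'-th orbit: modulo p
    only the term of x itself can survive, so the sum is k = a if i = i' and 0
    otherwise.  Counted point by point, the same sum adds, over the points u of
    x, the number of blocks of the i'-th orbit through u.  For u in the j-th
    point orbit, that number depends on j only, and double counting incidences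
    between the two orbits, which have the same length, shows that it is
    O i' j; as x has O i j points in the j-th orbit, the sum is
    \sum_j O i j * O i' j ([orbit_matrix_gram]).

    If s^2 = -a, the rows of M = [s I, O] hence satisfy M M^T = s^2 I + a I = 0,
    which is self-orthogonality.  As a is nonzero, s is invertible, so M has
    rank m; if m = n, the dual has dimension 2m - m = m as well, and the
    inclusion in the dual is an equality.

    It remains to find s in F, where F is known by its cardinality only.  In
    characteristic 2 every element is a square.  For an odd number of elements,
    squareness of a nonzero c is decided by Euler's criterion, a power of c
    being 1; as c lies in the prime field, such an equation holds in all fields
    of characteristic p at once, and so passes from F_q to F
    ([sqrt_prime_field]). *)

(** * Counting along enumerated orbits *)

Lemma card_setI_pred (T : finType) (A : {set T}) (b : pred T) :
  #|A :&: [set x | b x]| = (\sum_(x in A) b x)%N.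
Proof.
rewrite -sum1_card big_mkcond [RHS]big_mkcond /=; apply: eq_bigr => x _.
by rewrite !inE; case: (x \in A); case: (b x).
Qed.

Section OrbitEnumeration.

Variables (aT : finGroupType) (D : {group aT}) (T : finType).
Variables (to : action D T) (G : {group aT}) (n : nat) (f : 'I_n -> {set T}).
Hypotheses (sGD : G \subset D) (f_orbits : enumerates f (orbit to G @: setT)).

Lemma enum_orbitE i x : x \in f i -> f i = orbit to G x.
Proof.
have /imsetP[x0 _ ->] : f i \in orbit to G @: setT.
  by case: f_orbits => _ <-; apply: imset_f.
by move=> /(orbit_in_eqP sGD).
Qed.

Lemma enum_orbit_inhabited i : exists x, x \in f i.
Proof.
have /imsetP[x _ ->] : f i \in orbit to G @: setT.
  by case: f_orbits => _ <-; apply: imset_f.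
by exists x; apply: orbit_refl.
Qed.

Lemma enum_orbit_inj i i' x : x \in f i -> x \in f i' -> i = i'.
Proof.
case: (f_orbits) => f_inj _ xi xi'; apply: f_inj.
by rewrite (enum_orbitE xi) (enum_orbitE xi').
Qed.

Lemma mem_enum_orbit_act i g x : g \in G -> (to x g \in f i) = (x \in f i).
Proof.
by have [x0 /enum_orbitE->] := enum_orbit_inhabited i; apply: orbit_actr_in.
Qed.

Lemma sum_enum_orbits (E : T -> nat) :
  (\sum_x E x = \sum_i \sum_(x in f i) E x)%N.
Proof.
have [f_inj Ef] := f_orbits.
transitivity (\sum_(x in [set: T]) E x)%N; first by apply: eq_bigl => x; rewrite inE.
have /orbit_partition : [acts G, on setT | to].
  by apply/subsetP => g gG; rewrite !inE (subsetP sGD) //; apply/subsetP => x; rewrite !inE.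
move=> partT; rewrite (set_partition_big _ partT) -Ef big_imset /=; last by move=> i i' _ _ /f_inj.
by apply: eq_bigl => i.
Qed.

End OrbitEnumeration.

(** * The Gram matrix of the orbit matrix *)

Section OrbitCounting.

Variables (P B : finType) (I : P -> B -> bool).
Variable G : {group {perm P} * {perm B}}.
Hypothesis G_aut : G \subset design_aut I.
Variables (m n : nat) (Vs : 'I_n -> {set P}) (Bs : 'I_m -> {set B}).
Hypothesis Vs_orbits : enumerates Vs (point_orbits G).
Hypothesis Bs_orbits : enumerates Bs (block_orbits G).

Lemma aut_incidence g u x : g \in G -> I (g.1 u) (g.2 x) = I u x.
Proof.
by move=> /(subsetP G_aut); rewrite inE => /forallP/(_ u)/forallP/(_ x)/eqP.
Qed.

(** The two actions on points and blocks are partial actions in form, with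
    domain the preimage of the full symmetric group under a projection. *)
Lemma sub_proj_act_dom (T : finType)
    (h : {morphism [set: {perm P} * {perm B}] >-> {perm T}}) :
  G \subset (h @*^-1 [set: {perm T}])%g.
Proof. by apply/subsetP => g _; rewrite !inE. Qed.

(** An element of G moving u to u' permutes the blocks of Bs i and carries those
    through u onto those through u'. *)
Lemma point_degree_constant i j u u' : u \in Vs j -> u' \in Vs j ->
  #|Bs i :&: point_blocks I u| = #|Bs i :&: point_blocks I u'|.
Proof.
move=> uj; rewrite (enum_orbitE (sub_proj_act_dom _) Vs_orbits uj).
case/orbitP=> g gG <- /=.
have memB x : (g.2 x \in Bs i) = (x \in Bs i).
  exact: (mem_enum_orbit_act (sub_proj_act_dom _) Bs_orbits i x gG).
rewrite -(card_imset _ (@perm_inj _ g.2)); apply: eq_card => z.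
apply/imsetP/idP => [[x]|].
  by rewrite !inE => /andP[xB Iux] ->; rewrite memB aut_incidence // xB.
rewrite !inE -{1 2}(permKV g.2 z) memB aut_incidence // => zI.
by exists (g.2^-1 z)%g; rewrite ?permKV // !inE.
Qed.

Variable w : nat.
Hypothesis card_Vs : forall j, #|Vs j| = w.
Hypothesis card_Bs : forall i, #|Bs i| = w.

(** Point and block orbits play symmetric roles: both sides, multiplied by the
    common orbit length w, count the incidences between Vs j and Bs i.  This is
    where equality of the two lengths enters; it also makes the argument free of
    any division by w, which may vanish modulo p. *)
Lemma orbit_matrix_dual i j u : u \in Vs j ->
  orbit_matrix I Bs Vs i j = #|Bs i :&: point_blocks I u|.
Proof.
move=> uj; have w_gt0 : (0 < w)%N by rewrite -(card_Vs j); apply/card_gt0P; exists u.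
apply/eqP; rewrite -(eqn_pmul2l w_gt0) -{1}(card_Bs i) -(card_Vs j) -!sum_nat_const.
rewrite (eq_bigr (fun x => \sum_(u' in Vs j) I u' x)%N); last first.
  move=> x xi; rewrite (orbit_matrixE G_aut Bs_orbits Vs_orbits _ xi).
  exact: card_setI_pred.
rewrite exchange_big /=; apply/eqP/eq_bigr => u' u'j.
by rewrite (point_degree_constant i uj u'j); apply/esym/card_setI_pred.
Qed.

(** Both sides count the pairs of a point u of x and a block of Bs i' through
    u: orbit by orbit of points on the left, block by block on the right. *)
Lemma orbit_matrix_gram i i' x : x \in Bs i ->
  (\sum_j orbit_matrix I Bs Vs i j * orbit_matrix I Bs Vs i' j
     = \sum_(y in Bs i') #|block_points I x :&: block_points I y|)%N.
Proof.
move=> xi.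
transitivity (\sum_(u in block_points I x) #|Bs i' :&: point_blocks I u|)%N.
  rewrite [RHS]big_mkcond (sum_enum_orbits (sub_proj_act_dom _) Vs_orbits).
  apply: eq_bigr => j _.
  rewrite (orbit_matrixE G_aut Bs_orbits Vs_orbits _ xi) -sum_nat_const.
  rewrite -big_mkcondr /=; apply: eq_big => [u|u]; first by rewrite inE.
  by rewrite inE => /andP[uj _]; rewrite (orbit_matrix_dual _ uj).
transitivity (\sum_(u in block_points I x) \sum_(y in Bs i') I u y)%N.
  by apply: eq_bigr => u _; apply: card_setI_pred.
by rewrite exchange_big /=; apply: eq_bigr => y _; apply/esym/card_setI_pred.
Qed.

End OrbitCounting.

(** * Codes as row spaces *)

Section Codes.

Variable F : finFieldType.

Lemma mem_code_of m N (M : 'M[F]_(m, N)) x :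
  (x \in code_of M) = (x <= M)%MS.
Proof.
apply/idP/idP => [|/submxP[D ->]].
  rewrite /code_of; set X := [seq _ | _ : _] => xX.
  rewrite (coord_span (X := in_tuple X) xX); apply: summx_sub => i _.
  apply: scalemx_sub; have /mapP[i' _ ->] : (in_tuple X)`_i \in X by apply: mem_nth.
  exact: row_sub.
rewrite mulmx_sum_row; apply: memv_suml => i _; apply: memvZ.
by apply: memv_span; apply: image_f.
Qed.

Lemma card_rowspace m N (M : 'M[F]_(m, N)) :
  #|[pred x : 'rV[F]_N | (x <= M)%MS]| = (#|F| ^ \rank M)%N.
Proof.
rewrite -[RHS](_ : #|{: 'rV[F]_(\rank M)}| = _); last by rewrite card_mx mul1n.
pose f (D : 'rV[F]_(\rank M)) := D *m row_base M.
have f_inj : injective f by apply/row_free_inj/row_base_free.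
rewrite -(card_imset _ f_inj); apply: eq_card => x; rewrite inE.
rewrite -(eq_row_base M); apply/submxP/imsetP => [[D ->]|[D _ ->]]; by exists D.
Qed.

(** Comparing the numbers of elements avoids choosing a basis of the code. *)
Lemma dim_code_of m N (M : 'M[F]_(m, N)) : \dim (code_of M) = \rank M.
Proof.
have q1 : (1 < #|F|)%N := finNzRing_gt1 F.
apply/eqP; rewrite -(eqn_exp2l _ _ q1) -card_vspace -card_rowspace.
by apply/eqP/eq_card => x; rewrite inE -mem_code_of.
Qed.

Lemma dual_code_of m N (M : 'M[F]_(m, N)) x :
  (x \in dual_code (code_of M)) = (x <= kermx M^T)%MS.
Proof.
have dotE y : dotv x y = (x *m y^T) 0 0.
  by rewrite mxE; apply: eq_bigr => i _; rewrite mxE.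
rewrite inE sub_kermx; apply/forallP/eqP => [xC|xM y].
  apply/rowP => i; have := xC (row i M).
  rewrite mem_code_of row_sub /= => /eqP xi.
  by rewrite mxE [RHS]mxE -[RHS]xi; apply: eq_bigr => j _; rewrite !mxE.
apply/implyP; rewrite mem_code_of => /submxP[D ->].
by rewrite dotE trmx_mul mulmxA xM mul0mx mxE.
Qed.

Lemma self_orthogonal_code_of m N (M : 'M[F]_(m, N)) :
  M *m M^T = 0 -> self_orthogonal (code_of M).
Proof.
move=> MM x; rewrite mem_code_of dual_code_of => /submx_trans-> //.
exact/sub_kermxP.
Qed.

(** The dual has dimension N - \rank M = \rank M, so a code contained in its
    dual fills it. *)
Lemma self_dual_code_of m N (M : 'M[F]_(m, N)) :
  M *m M^T = 0 -> (\rank M + \rank M)%N = N -> self_dual (code_of M).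
Proof.
move=> MM rM x; rewrite mem_code_of dual_code_of.
have sub : (M <= kermx M^T)%MS by apply/sub_kermxP.
suff /andP[_ eqM] : (M == kermx M^T)%MS.
  by apply/idP/idP => /submx_trans; apply.
by rewrite -(mxrank_leqif_eq sub) mxrank_ker mxrank_tr -[X in (X - _)%N]rM addnK.
Qed.

Lemma rank_scalar_row_mx m n (s : F) (O : 'M[F]_(m, n)) :
  s != 0 -> \rank (row_mx s%:M O) = m.
Proof.
move=> s0; apply/eqP; rewrite -[_ == _]/(row_free _); apply/row_freeP.
exists (col_mx (s^-1)%:M 0).
by rewrite mul_row_col mulmx0 addr0 -scalar_mxM divff.
Qed.

Lemma scalar_row_mx_gram m n (s a : F) (O : 'M[F]_(m, n)) :
  s ^+ 2 = - a -> O *m O^T = a%:M ->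
  row_mx s%:M O *m (row_mx s%:M O)^T = 0.
Proof.
move=> sa OO; rewrite tr_row_mx tr_scalar_mx mul_row_col OO -scalar_mxM -expr2 sa.
by rewrite -raddfD /= addNr raddf0.
Qed.

End Codes.

(** * Square roots of elements of the prime field *)

Section Squares.

(** With c^h = 1, the polynomial X^2 - c divides X (X^(2h) - c^h) = X^|F| - X,
    which is a product of linear factors, so X^2 - c has a root. *)
Lemma sqrt_of_Euler (F : finFieldType) h (c : F) :
  #|F| = h.*2.+1 -> c ^+ h = 1 -> exists s, s ^+ 2 = c.
Proof.
move=> cF ch.
have dvd : 'X^2 - c%:P %| \prod_x ('X - x%:P).
  rewrite -finField_genPoly.
  have -> : 'X^#|F| - 'X = ('X^2 ^+ h - c%:P ^+ h) * 'X :> {poly F}.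
    by rewrite -exprM mul2n -[c%:P ^+ h]rmorphXn ch mulrBl mul1r -exprSr cF.
  by rewrite subrXX -mulrA dvdp_mulr.
move: dvd; rewrite -big_enum => /dvdp_prod_XsubC[mk eqp_mk].
have := eqp_size eqp_mk; rewrite size_XnsubC // size_prod_XsubC => /esym/eqP.
rewrite eqSS; case E: (mask mk _) eqp_mk => [|s rs] // eqp_s _.
exists s; have : root ('X^2 - c%:P) s.
  by rewrite (eqp_root eqp_s) root_prod_XsubC mem_head.
by rewrite rootE !hornerE subr_eq0 => /eqP.
Qed.

(** Equations between integers seen in a field of characteristic p are
    congruences modulo p: this replaces any embedding of one field in another. *)
Lemma nat_eq1_transfer (p : nat) (F F' : nzRingType) (d : nat) :
  p \in [pchar F] -> p \in [pchar F'] -> d%:R = 1 :> F -> d%:R = 1 :> F'.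
Proof.
move=> pF pF'; case: d => [/esym/eqP|d]; first by rewrite oner_eq0.
move/eqP; rewrite -natr1 -subr_eq0 addrK -(dvdn_pcharf pF) (dvdn_pcharf pF') => /eqP d0.
by rewrite -natr1 d0 add0r.
Qed.

(** For q = 2h + 1, a square root t in Fq gives d^h = t^(q - 1) = 1, and F with q
    elements inherits a square root.  For |F| = q^2, the exponent in Euler's
    criterion is (q^2 - 1) / 2 = (q - 1)(h + 1), and d^(q - 1) = 1 always. *)
Lemma sqrt_prime_field (p l : nat) (Fq F : finFieldType) (d : nat) :
    prime p -> ~~ (p %| d)%N -> #|Fq| = (p ^ l)%N ->
    #|F| = (if is_square (d%:R : Fq) then p ^ l else (p ^ l) ^ 2)%N ->
  exists s : F, s ^+ 2 = d%:R.
Proof.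
move=> p_pr p_d cFq cF.
have pFq := card_finPcharP cFq p_pr.
have [e cFe] : exists e, #|F| = (p ^ e)%N.
  by rewrite cF; case: ifP => _; [exists l | exists (l * 2)%N; rewrite expnM].
have pF := card_finPcharP cFe p_pr.
have d0 : d%:R != 0 :> Fq by rewrite -(dvdn_pcharf pFq).
have [oddq|] := boolP (odd #|Fq|); last first.
  (* Here d = d^|F|, an even power of d. *)
  move=> evenq; exists (d%:R ^+ #|F|./2); rewrite -exprM muln2 even_halfK ?expf_card //.
  by rewrite cF -cFq; case: ifP => _ //; rewrite oddX.
pose h := #|Fq|./2.
have q_h : #|Fq| = h.*2.+1 by rewrite -(odd_double_half #|Fq|) oddq.
have fermat (y : Fq) : y != 0 -> y ^+ h.*2 = 1.
  by move=> y0; apply: (mulfI y0); rewrite -exprS -q_h expf_card mulr1.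
case: ifP cF => [/existsP[t /eqP t2]|_] cF.
  apply: (@sqrt_of_Euler _ h); first by rewrite cF -cFq.
  rewrite -natrX; apply: (nat_eq1_transfer pFq) => //.
  rewrite natrX -t2 -exprM mul2n fermat //.
  by apply: contraNneq d0 => t0; rewrite -t2 t0 expr0n.
apply: (@sqrt_of_Euler _ (h.*2 * h.+1)%N).
  rewrite cF -cFq q_h -addn1 sqrnD exp1n muln1 addnAC addn1; congr _.+1.
  by rewrite -!mul2n mulnS mulnDr -mulnn addnC -!mulnA (mulnCA h).
rewrite exprM -natrX (nat_eq1_transfer pFq pF) ?expr1n //.
by rewrite natrX fermat.
Qed.

End Squares.

Theorem theorem15
    (p l : nat) (p_prime : prime p) (l_gt0 : (0 < l)%N)
    (Fq : finFieldType) (card_Fq : #|Fq| = (p ^ l)%N)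
    (P B : finType) (I : P -> B -> bool) (v k r : nat)
    (design : is_1design I v k r)
    (a : 'F_p) (a_neq0 : a != 0)
    (block_size_mod : k%:R = a)
    (block_meet_mod : forall x y : B, x != y ->
       (#|block_points I x :&: block_points I y| = 0 %[mod p])%N)
    (G : {group {perm P} * {perm B}}) (G_aut : G \subset design_aut I)
    (m n w : nat)
    (Vs : 'I_n -> {set P}) (Vs_orbits : enumerates Vs (point_orbits G))
    (Bs : 'I_m -> {set B}) (Bs_orbits : enumerates Bs (block_orbits G))
    (card_Vs : forall j, #|Vs j| = w) (card_Bs : forall i, #|Bs i| = w)
    (F : finFieldType)
    (card_F : #|F| = (if is_square (- Fp_in Fq a) then p ^ l
                      else (p ^ l) ^ 2)%N) :
  (exists s : F, s ^+ 2 = - Fp_in F a) /\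
  (forall s : F, s ^+ 2 = - Fp_in F a ->
     let O : 'M[F]_(m, n) :=
       map_mx (fun c : nat => c%:R) (orbit_matrix I Bs Vs) in
     let C := code_of (row_mx (s%:M : 'M[F]_m) O) in
     [/\ self_orthogonal C, \dim C = m & (m = n -> self_dual C)]).
Proof.
have pFq := card_finPcharP card_Fq p_prime.
have [e cFe] : exists e, #|F| = (p ^ e)%N.
  by rewrite card_F; case: ifP => _; [exists l | exists (l * 2)%N; rewrite expnM].
have pF := card_finPcharP cFe p_prime.
have p_k : ~~ (p %| k)%N.
  by rewrite (dvdn_pcharf (pchar_Fp p_prime)) block_size_mod.
have Fp_inE (K : nzRingType) : p \in [pchar K] -> Fp_in K a = k%:R.
  move=> pK; rewrite /Fp_in -block_size_mod val_Fp_nat //.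
  by rewrite [in RHS](divn_eq k p) natrD natrM (pcharf0 pK) mulr0 add0r.
have natN (K : nzRingType) : p \in [pchar K] -> - k%:R = (p.-1 * k)%:R :> K.
  move=> pK; apply/esym/eqP; rewrite -addr_eq0 -natrD -mulSnr prednK ?prime_gt0 //.
  by rewrite natrM (pcharf0 pK) mul0r.
split.
  rewrite Fp_inE // natN //; apply: (sqrt_prime_field p_prime _ card_Fq).
    rewrite Euclid_dvdM // negb_or p_k andbT.
    have := prime_gt1 p_prime; case: (p) => // q q_gt0.
    by rewrite gtnNdvd.
  by rewrite card_F Fp_inE // natN.
move=> s s2 O C.
have k0 : k%:R != 0 :> F by rewrite -(dvdn_pcharf pF).
have {}s2 : s ^+ 2 = - k%:R by rewrite s2 Fp_inE.
have s0 : s != 0.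
  by apply: contraNneq k0 => s0; rewrite -oppr_eq0 -s2 s0 expr0n.
have OO : O *m O^T = (k%:R)%:M.
  apply/matrixP => i i'.
  have [x xi] := enum_orbit_inhabited Bs_orbits i.
  transitivity ((\sum_j orbit_matrix I Bs Vs i j * orbit_matrix I Bs Vs i' j)%N%:R : F).
    by rewrite mxE natr_sum; apply: eq_bigr => j _; rewrite natrM !mxE.
  rewrite (orbit_matrix_gram G_aut Vs_orbits Bs_orbits card_Vs card_Bs i' xi).
  have meet0 y : y != x -> #|block_points I x :&: block_points I y|%:R = 0 :> F.
    rewrite eq_sym => /block_meet_mod/eqP; rewrite mod0n => meet.
    by apply/eqP; rewrite -(dvdn_pcharf pF).
  rewrite natr_sum mxE; have [<-|ii'] := eqVneq i i'.
    rewrite (bigD1 x) //= setIid big1 ?addr0; last by move=> y /andP[_ /meet0].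
    by case: design => _ -> _.
  rewrite big1 // => y yi'; apply: meet0; apply: contraNneq ii' => yx.
  apply/eqP; rewrite yx in yi'.
  exact: (enum_orbit_inj (sub_proj_act_dom _ _) Bs_orbits xi yi').
have MM := scalar_row_mx_gram s2 OO.
have rM := rank_scalar_row_mx O s0.
split; first exact: self_orthogonal_code_of.
  by rewrite dim_code_of.
by move=> mn; apply: self_dual_code_of; rewrite // rM {2}mn.
Qed.
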